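(* Let $r=p^m$ and $q=r^2$, where $p$ is an odd prime and $m$ is a positive integer. Let $t$ and $s$ be even integers with $1\le t\le r$ and $0\le s\le p^{m-t'}-1$, where $t'=\lceil\log_p(t)\rceil$, and let $n=tr+sp^{t'}$. Then there exists a $q$-ary NMDS self-dual code of length $n$.
   Context: A $q$-ary $[n,k,d]$-linear code is a subspace $\mathcal C$ of $\mathbb F_q^n$ (with $\mathbb F_q$ the finite field of $q$ elements) of dimension $k$ and minimum (Hamming) distance $d$; $n$ is its length. Its dual is $\mathcal C^{\bot}=\{b\in\mathbb F_q^n : \sum_{i=1}^n a_ib_i=0 \text{ for all } a\in\mathcal C\}$; $\mathcal C$ is self-dual if $\mathcal C=\mathcal C^{\bot}$. An $[n,k,d]$-linear code is AMDS if $d=n-k$. An AMDS code $\mathcal C$ is NMDS if $\mathcal C^{\bot}$ is also AMDS. *)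

(* Defs.v *)
From HB Require Import structures.
From mathcomp Require Import all_boot all_order all_algebra.

Set Implicit Arguments.
Unset Strict Implicit.
Unset Printing Implicit Defensive.

Import GRing.Theory.
Local Open Scope ring_scope.

Definition hamming_dist (F : finFieldType) (n : nat) (x y : 'rV[F]_n) : nat :=
  #|[set i : 'I_n | x 0 i != y 0 i]|.

(* No [d] satisfies this when [C] is the zero code. *)
Definition is_min_dist (F : finFieldType) (n : nat) (C : {vspace 'rV[F]_n})
    (d : nat) : Prop :=
  (exists x y, [/\ x \in C, y \in C, x != y & hamming_dist x y = d]) /\
  (forall x y, x \in C -> y \in C -> x != y -> (d <= hamming_dist x y)%N).

Definition linear_code (F : finFieldType) (n k d : nat)
    (C : {vspace 'rV[F]_n}) : Prop :=
  \dim C = k /\ is_min_dist C d.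

(* [dual_codeP] gives the defining orthogonality condition. *)
Definition dual_code (F : finFieldType) (n : nat) (C : {vspace 'rV[F]_n}) :
    {vspace 'rV[F]_n} :=
  (\bigcap_(a : 'rV[F]_n | a \in C) lker (linfun (mulmxr a^T : 'rV_n -> 'M_1)))%VS.

Lemma dual_codeP (F : finFieldType) (n : nat) (C : {vspace 'rV[F]_n})
    (b : 'rV[F]_n) :
  reflect (forall a, a \in C -> \sum_(i < n) a 0 i * b 0 i = 0)
          (b \in dual_code C).
Proof.
have E a : (b \in lker (linfun (mulmxr a^T : 'rV_n -> 'M_1)))
         = (\sum_(i < n) a 0 i * b 0 i == 0).
  rewrite memv_ker lfunE /=; apply/eqP/eqP => [/matrixP/(_ 0 0) | h].
    by rewrite !mxE => {2}<-; apply: eq_bigr => i _; rewrite mxE mulrC.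
  apply/matrixP => i j; rewrite !ord1 !mxE -{2}h.
  by apply: eq_bigr => k _; rewrite mxE mulrC.
apply: (iffP idP) => [bC a aC | h].
  by apply/eqP; rewrite -E; apply: subvP bC; apply: bigcapv_inf aC _.
rewrite memvE; apply/subv_bigcapP => a aC.
by rewrite -memvE E; apply/eqP/h.
Qed.

Definition self_dual (F : finFieldType) (n : nat) (C : {vspace 'rV[F]_n}) : Prop :=
  C = dual_code C.

Definition AMDS (F : finFieldType) (n : nat) (C : {vspace 'rV[F]_n}) : Prop :=
  exists k d, linear_code k d C /\ d = (n - k)%N.

Definition NMDS (F : finFieldType) (n : nat) (C : {vspace 'rV[F]_n}) : Prop :=
  AMDS C /\ AMDS (dual_code C).

(* Main.v *)
Require Import Defs.
From HB Require Import structures.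
From mathcomp Require Import all_boot all_order all_algebra all_fingroup all_solvable all_field.
From mathcomp Require Import zify.

Set Implicit Arguments.
Unset Strict Implicit.
Unset Printing Implicit Defensive.

Import GRing.Theory FinRing.Theory.
Local Open Scope ring_scope.

(** Let A be a set of n = 2k points of F_q with sum 0, and evaluate on A the
    polynomials spanned by 1, X, ..., X^(k-2), X^k, multiplying the value at a
    by v(a).  Put delta(a) = prod_(b in A, b <> a) (a - b).  By Lagrange
    interpolation, sum_(a in A) a^e / delta(a) vanishes for e <= 2k - 2, and for
    e = 2k because A has sum 0; hence the code is self-dual as soon as
    v(a)^2 = w / delta(a) for a constant w.  A nonzero polynomial in the span has
    at most k roots, and it has k roots in A exactly when some k-subset of A has
    sum 0; in that case the minimum distance is k = n - k.

    To choose A, write sigma(x) = x^r and split F_q = K + M into the eigenspaces of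
    sigma for 1 and -1, both of order r.  Split M in turn as H + L with
    |H| = p^t'.  Take T in H and R in L of sizes t/2 and s/2, each disjoint from
    its opposite, and A = ((T u -T) + K) u ((R u -R) + H).  Since A = -A has even
    order, and (T u -T) + K and (R u -R) + H are unions of cosets of K and H
    respectively, sigma(delta(a)) = - delta(a) on A.  For w in M nonzero, w / delta(a)
    is then in the subfield K of order r, so it is a square in F_q.  Finally
    (T + K) u (R + H) is a k-subset of A with sum 0. *)

(** * Difference products and Lagrange interpolation *)

Definition diff_prod (F : finFieldType) (A : {set F}) (a : F) : F :=
  \prod_(b in A | b != a) (a - b).

Lemma diff_prod_neq0 (F : finFieldType) (A : {set F}) (a : F) :
  diff_prod A a != 0.
Proof. by apply/prodf_neq0 => b /andP[_]; rewrite subr_eq0 eq_sym. Qed.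

Lemma card_roots_set (F : finFieldType) (f : {poly F}) (A : {set F}) :
  f != 0 -> (#|[set a in A | root f a]| < size f)%N.
Proof.
move=> f0; rewrite cardE; apply: max_poly_roots (enum_uniq _) => //.
by apply/allP => a; rewrite mem_enum inE => /andP[].
Qed.

Lemma poly_eq_on_set (F : finFieldType) (f g : {poly F}) (A : {set F}) :
  (size f <= #|A|)%N -> (size g <= #|A|)%N ->
  {in A, forall a, f.[a] = g.[a]} -> f = g.
Proof.
move=> sf sg fg; apply/eqP; rewrite -subr_eq0; apply/negPn/negP => /card_roots_set.
move=> /(_ A); rewrite ltnNge => /negP; apply.
apply: leq_trans (size_polyD _ _) _; rewrite size_polyN geq_max.
have -> : [set a in A | root (f - g) a] = A; last by rewrite sf sg.
apply/setP => a; rewrite inE rootE !hornerE.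
by case: (boolP (a \in A)) => //= /fg->; rewrite subrr eqxx.
Qed.

Lemma size_prod_XsubC_set (R : comNzRingType) (T : finType) (A : {set T}) (h : T -> R) :
  size (\prod_(a in A) ('X - (h a)%:P)) = #|A|.+1.
Proof. by rewrite -big_enum size_prod_XsubC -cardE. Qed.

Lemma subtop_coef_prod_XsubC (F : finFieldType) (A : {set F}) :
  (0 < #|A|)%N ->
  (\prod_(a in A) ('X - a%:P))`_#|A|.-1 = - \sum_(a in A) a.
Proof.
rewrite -big_enum /= cardE => A0.
by rewrite coefPn_prod_XsubC ?big_enum // -lt0n.
Qed.

(** Both sides are the top coefficient of the interpolant of [f] on [A]: before normalization by
    [diff_prod A a], each Lagrange basis polynomial [l a] is monic of degree [#|A|.-1]. *)
Lemma lagrange_lead_coef (F : finFieldType) (A : {set F}) (f : {poly F}) :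
  (size f <= #|A|)%N ->
  \sum_(a in A) f.[a] / diff_prod A a = f`_(#|A|.-1).
Proof.
move=> sf.
pose l a := \prod_(b in A :\ a) ('X - b%:P).
have sl a : a \in A -> size (l a) = #|A|.
  by move=> aA; rewrite size_prod_XsubC_set [RHS](cardsD1 a A) aA.
have lE a : (l a).[a] = diff_prod A a.
  rewrite horner_prod /diff_prod; apply: eq_big => [b | b _]; last by rewrite !hornerE.
  by rewrite !inE andbC.
have l0 a b : b \in A -> b != a -> (l a).[b] = 0.
  move=> bA ba; rewrite horner_prod (bigD1 b) ?inE ?ba //= !hornerE.
  by rewrite subrr mul0r.
have -> : f = \sum_(a in A) (f.[a] / diff_prod A a) *: l a.
  apply: (@poly_eq_on_set _ _ _ A) => //.
    apply: leq_trans (size_sum _ _ _) _; apply/bigmax_leqP => a aA.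
    by apply: leq_trans (size_scale_leq _ _) _; rewrite sl.
  move=> b bA; rewrite horner_sum (bigD1 b) //= hornerZ lE divfK ?diff_prod_neq0 //.
  by rewrite big1 ?addr0 // => a /andP[_ ab]; rewrite hornerZ l0 ?mulr0 // eq_sym.
rewrite coef_sum; apply: eq_bigr => a aA.
rewrite coefZ -(sl a aA) -[_`_(_.-1)]/(lead_coef _) lead_coef_prod_XsubC mulr1.
rewrite horner_sum (bigD1 a) //= hornerZ lE divfK ?diff_prod_neq0 //.
by rewrite big1 ?addr0 // => b /andP[_ ab]; rewrite hornerZ l0 ?mulr0 // eq_sym.
Qed.

(** * The evaluation code attached to a point set *)

Section TwistedCode.

Variables (F : finFieldType) (A I : {set F}) (k : nat) (lambda : F) (v : F -> F).
Hypotheses (k_gt0 : (0 < k)%N) (cardA : #|A| = k.*2) (cardI : #|I| = k).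
Hypotheses (sumA : \sum_(a in A) a = 0) (sumI : \sum_(a in I) a = 0).
Hypotheses (sIA : I \subset A) (lambda_neq0 : lambda != 0).
Hypothesis v_sqr : {in A, forall a, v a ^+ 2 = lambda / diff_prod A a}.

(** The exponents are 0, ..., k-2, k; the gap at k-1 is what brings in the conditions on sums of
    points. *)
Let expo (j : 'I_k) : nat := if j == k.-1 :> nat then k else j.

Let expo_inj : injective expo.
Proof.
move=> i j; rewrite /expo => h; apply/val_inj.
by move: h (ltn_ord i) (ltn_ord j); case: (val i =P k.-1); case: (val j =P k.-1) => /=; lia.
Qed.

Let pol (c : 'rV[F]_k) : {poly F} := \sum_j c 0 j *: 'X^(expo j).

Let coef_pol c j : (pol c)`_(expo j) = c 0 j.
Proof.
rewrite coef_sum (bigD1 j) //= coefZ coefXn eqxx mulr1 big1 ?addr0 // => i ij.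
by rewrite coefZ coefXn (inj_eq expo_inj) eq_sym (negPf ij) mulr0.
Qed.

Let size_pol c : (size (pol c) <= k.+1)%N.
Proof.
apply: leq_trans (size_sum _ _ _) _; apply/bigmax_leqP => j _.
apply: leq_trans (size_scale_leq _ _) _; rewrite size_polyXn ltnS /expo.
by case: ifP => // _; apply: ltnW.
Qed.

Let pol_neq0 (c : 'rV_k) : c != 0 -> pol c != 0.
Proof.
apply: contraNN => /eqP c0; apply/eqP/rowP => j.
by rewrite mxE -coef_pol c0 coef0.
Qed.

Let pol_surj (f : {poly F}) :
  (size f <= k.+1)%N -> f`_k.-1 = 0 -> exists c, f = pol c.
Proof.
move=> sf fk; exists (\row_j f`_(expo j)); apply/polyP => i.
rewrite coef_sum.
under eq_bigr => j _ do rewrite coefZ coefXn mxE.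
case: (boolP [exists j, expo j == i]) => [/existsP[j /eqP<-] | /existsPn h].
  rewrite (bigD1 j) //= eqxx mulr1 big1 ?addr0 // => l lj.
  by rewrite (inj_eq expo_inj) eq_sym (negPf lj) mulr0.
rewrite big1 => [|j _]; last by rewrite eq_sym (negPf (h j)) mulr0.
have [->//|ik] := eqVneq i k.-1.
have [ltik|leki] := ltnP i k.
  by have:= h (Ordinal ltik); rewrite /expo /= (negPf ik) eqxx.
rewrite nth_default // (leq_trans sf) // ltn_neqAle leki andbT.
have lt1 : (k.-1 < k)%N by rewrite prednK.
by have:= h (Ordinal lt1); rewrite /expo /= eqxx.
Qed.

Let G : 'M[F]_(k, #|A|) :=
  \matrix_(j, i) (v (enum_val i) * enum_val i ^+ expo j).

Let mulG (c : 'rV_k) i : (c *m G) 0 i = v (enum_val i) * (pol c).[enum_val i].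
Proof.
rewrite mxE horner_sum big_distrr; apply: eq_bigr => j _.
by rewrite mxE hornerZ hornerXn /= mulrCA.
Qed.

Let v_neq0 a : a \in A -> v a != 0.
Proof.
move=> aA; rewrite -sqrf_eq0 v_sqr // mulf_neq0 ?invr_eq0 ?diff_prod_neq0 //.
Qed.

(** Since [v] does not vanish on [A], the zero coordinates of a codeword are exactly the roots of
    its polynomial in [A]. *)
Let weight (c : 'rV_k) :
  (#|[set i | (c *m G)%R 0%R i != 0%R]| + #|[set a in A | root (pol c) a]| = k.*2)%N.
Proof.
have -> : #|[set a in A | root (pol c) a]| = #|[set i | (c *m G) 0 i == 0]|.
  rewrite -(card_imset _ enum_val_inj); apply: eq_card => a; rewrite inE.
  apply/andP/imsetP => [[aA ra]|[i]].
    exists (enum_rank_in aA a); rewrite ?enum_rankK_in // inE mulG.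
    by rewrite enum_rankK_in // (eqP ra) mulr0.
  rewrite inE mulG mulf_eq0 => + ->; have iA := enum_valP i.
  by rewrite (negPf (v_neq0 iA)) rootE.
rewrite -cardA -[RHS]card_ord addnC -(cardsC [set i | (c *m G) 0 i == 0]).
by congr (_ + _)%N; apply: eq_card => i; rewrite !inE.
Qed.

Let weight_ge (c : 'rV_k) : c != 0 -> (k <= #|[set i | (c *m G)%R 0%R i != 0%R]|)%N.
Proof.
move=> /pol_neq0 /card_roots_set - /(_ A); have:= weight c; have:= size_pol c.
lia.
Qed.

Let mulG_eq0 (c : 'rV_k) : c *m G = 0 -> c = 0.
Proof.
move=> cG; apply/eqP; apply: contraTT k_gt0 => /weight_ge.
rewrite cG -leqNgt (_ : [set i | _] = set0) ?cards0 //.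
by apply/setP => i; rewrite !inE mxE eqxx.
Qed.

Let rankG : \rank G = k.
Proof.
apply/eqP; rewrite -/(row_free G) -kermx_eq0; apply/rowV0P => c.
by move/sub_kermxP/mulG_eq0.
Qed.

Let dist_mulG (c d : 'rV_k) :
  hamming_dist (c *m G) (d *m G) = #|[set i | ((c - d) *m G) 0 i != 0]|.
Proof.
by apply: eq_card => i; rewrite !inE mulmxBl !mxE subr_eq0.
Qed.

Let G_orth : G *m G^T = 0.
Proof.
have power_sum e : (e <= k.*2)%N -> e != k.*2.-1 ->
    \sum_(a in A) a ^+ e / diff_prod A a = 0.
  move=> e_le e_neq; have [e_lt|] := ltnP e k.*2.-1.
    have := @lagrange_lead_coef _ A 'X^e; rewrite size_polyXn coefXn cardA.
    rewrite eq_sym (negPf e_neq) mulr0n => h; rewrite -[RHS]h; last by lia.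
    by apply: eq_bigr => a _; rewrite hornerXn.
  rewrite leq_eqVlt eq_sym (negPf e_neq) => /= e_gt.
  have -> : e = k.*2 by lia.
  (* For e = 2k the degree is too large for interpolation. Subtracting [g] keeps the values on [A]
     and cancels the leading term; the coefficient at 2k-1 is then the sum of [A], which is 0. *)
  pose g := \prod_(a in A) ('X - a%:P).
  have sg : size g = #|A|.+1 by rewrite size_prod_XsubC_set.
  have gmon : g \is monic by rewrite monic_prod_XsubC.
  have := @lagrange_lead_coef _ A ('X^(k.*2) - g).
  have -> : ('X^(k.*2) - g)`_#|A|.-1 = 0.
    rewrite coefB coefXn cardA (_ : _ == _ = false) ?sub0r -?cardA; last by lia.
    by rewrite /g subtop_coef_prod_XsubC ?cardA ?double_gt0 // sumA opprK.
  move=> h; rewrite -[RHS]h.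
    apply: eq_bigr => a aA; congr (_ / _); rewrite !hornerE /= horner_prod.
    by rewrite [X in _ - X](bigD1 a) //= !hornerE subrr mul0r subr0.
  apply/leq_sizeP => j; rewrite leq_eqVlt => /predU1P[<-|ltj].
    rewrite coefB coefXn cardA eqxx -cardA; move: (monicP gmon).
    by rewrite /lead_coef sg /= => ->; rewrite subrr.
  by rewrite coefB coefXn nth_default ?sg // subr0; case: eqP => //; lia.
apply/matrixP => i j; rewrite !mxE.
under eq_bigr => l _ do rewrite !mxE mulrACA -expr2 -exprD.
rewrite -(big_enum_val (fun a => v a ^+ 2 * a ^+ (expo i + expo j))) /=.
transitivity (lambda * \sum_(a in A) a ^+ (expo i + expo j) / diff_prod A a).
  rewrite big_distrr /=; apply: eq_bigr => a aA.
  by rewrite v_sqr // mulrAC mulrA.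
(* Two exponents never add up to 2k-1: two below k-1 give at most 2k-4, one of them with k at most
   2k-2, and k twice gives 2k. *)
rewrite power_sum ?mulr0 //; rewrite /expo;
  by move: (ltn_ord i) (ltn_ord j); case: (val i =P k.-1); case: (val j =P k.-1) => /=; lia.
Qed.

Let C : {vspace 'rV[F]_#|A|} := limg (linfun (mulmxr G : 'rV_k -> 'rV_#|A|)).

Let memC x : reflect (exists c : 'rV_k, x = c *m G) (x \in C).
Proof.
apply: (iffP memv_imgP) => [[c _ ->]|[c ->]]; exists c; rewrite ?memvf //;
  by rewrite lfunE.
Qed.

Let dimC : \dim C = k.
Proof.
rewrite limg_dim_eq ?dimvf /dim ?mul1r //= ?mul1n //.
apply/eqP; rewrite -subv0; apply/subvP => c; rewrite memv_cap memvf memv_ker lfunE /=.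
by move/eqP/mulG_eq0->; rewrite mem0v.
Qed.

Let self_dualC : self_dual C.
Proof.
apply/vspaceP => b; apply/memC/dual_codeP => [[c ->] a /memC[d ->]|bC].
  transitivity (((d *m G) *m (c *m G)^T) 0 0); last first.
    by rewrite trmx_mul mulmxA -[d *m G *m _]mulmxA G_orth mulmx0 mul0mx mxE.
  by rewrite mxE; apply: eq_bigr => i _; rewrite [X in _ = _ * X]mxE.
apply/submxP.
(* [G_orth] gives one inclusion of row spaces; both ranks equal k, as 2k - k = k, so the row space
   of [G] is the whole kernel. *)
have /mxrank_leqif_eq[_ h] : (G <= kermx G^T)%MS by apply/sub_kermxP.
have : (G == kermx G^T)%MS.
  by rewrite -h mxrank_ker mxrank_tr rankG cardA -addnn addnK.
case/andP => _ h2; apply: submx_trans h2; apply/sub_kermxP.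
apply/rowP => j; rewrite !mxE.
have /bC : row j G \in C by apply/memC; exists (delta_mx 0 j); rewrite rowE.
by move=> rowE0; rewrite -[RHS]rowE0; apply: eq_bigr => i _; rewrite !mxE mulrC.
Qed.

Let min_distC : is_min_dist C k.
Proof.
split=> [|x y /memC[c ->] /memC[d ->] xy]; last first.
  by rewrite dist_mulG weight_ge // subr_eq0; apply: contraNneq xy => ->.
(* A word of weight k: [f] lies in the span because its coefficient at k-1 is minus the sum of [I],
   and it has k roots in [A]. *)
pose f := \prod_(a in I) ('X - a%:P).
have sf : size f = k.+1 by rewrite size_prod_XsubC_set cardI.
have [c fc] : exists c, f = pol c.
  apply: pol_surj; first by rewrite sf.
  by rewrite -cardI subtop_coef_prod_XsubC ?cardI // sumI oppr0.
have rootf : [set a in A | root (pol c) a] = I.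
  apply/setP => a; rewrite inE -fc /f -big_enum /= root_prod_XsubC mem_enum.
  by apply: andb_idl; apply: subsetP.
have c0 : c != 0.
  apply: contraTneq k_gt0 => c0; move: sf; rewrite fc c0 /pol big1 ?size_poly0 //.
  by move=> j _; rewrite mxE scale0r.
exists (c *m G), 0; split; rewrite ?mem0v //; first by apply/memC; exists c.
  by apply: contra_neq c0; apply: mulG_eq0.
rewrite -[0](mul0mx _ G) dist_mulG subr0; have:= weight c.
by rewrite rootf cardI; lia.
Qed.

Lemma twisted_code_NMDS :
  exists C : {vspace 'rV[F]_#|A|}, NMDS C /\ self_dual C.
Proof.
have amds : AMDS C by exists k, k; split=> //; rewrite cardA -addnn addnK.
by exists C; split=> //; split=> //; rewrite -self_dualC.
Qed.

End TwistedCode.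

(** * Euler's criterion and Frobenius powers *)

(** By counting: the nonzero squares [S] lie among the roots [U] of X^e - 1, which number at most e,
    while squaring is at most two-to-one on the 2e nonzero elements. Hence [S = U]. *)
Lemma euler_criterion (F : finFieldType) (x : F) :
  odd #|F| -> x ^+ #|F|.-1./2 = 1 -> exists y, y ^+ 2 = x.
Proof.
move=> oddF; set e := #|F|.-1./2 => xe.
have [F_gt0 Fe] : (0 < #|F|)%N /\ (e * 2 = #|F|.-1)%N.
  by rewrite /e; case: #|F| oddF => //= j evj; rewrite muln2 even_halfK.
have e_gt0 : (0 < e)%N.
  have := finNzRing_gt1 F; rewrite -(prednK F_gt0) -Fe ltnS.
  by rewrite muln_gt0 andbT.
pose S := [set y ^+ 2 | y in [set~ (0 : F)]].
pose U := [set y in setT | root ('X^e - 1%:P) (y : F)].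
have U_le : (#|U| <= e)%N.
  have := @card_roots_set F ('X^e - 1%:P) setT.
  by rewrite size_XnsubC // ltnS; apply; rewrite -size_poly_eq0 size_XnsubC.
have S_ge : (e <= #|S|)%N.
  rewrite -(leq_pmul2r (isT : 0 < 2)%N) Fe -(cardsC1 (0 : F)).
  rewrite -sum1_card (partition_big_imset (fun y : F => y ^+ 2)) /= -/S -sum_nat_const.
  apply: leq_sum => z _.
  have := @card_roots_set F ('X^2 - z%:P) setT.
  rewrite size_XnsubC // ltnS => h; apply: leq_trans (h _); last first.
    by rewrite -size_poly_eq0 size_XnsubC.
  rewrite sum1_card; apply/subset_leq_card/subsetP => y.
  by rewrite !inE rootE !hornerE subr_eq0 => /andP[].
have sSU : S \subset U.
  apply/subsetP => _ /imsetP[y y0 ->]; rewrite !inE rootE !hornerE -exprM mulnC Fe.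
  rewrite subr_eq0; apply/eqP/(mulfI (x := y)); first by rewrite !inE in y0.
  by rewrite -exprS prednK ?expf_card ?mulr1.
have /eqP SU : S == U by rewrite eqEcard sSU (leq_trans U_le).
have : x \in U by rewrite !inE rootE !hornerE xe subrr.
by rewrite -SU => /imsetP[y _ ->]; exists y.
Qed.

Lemma frobenius_rmorphism (F : finFieldType) (p m : nat) :
  p \in [pchar F] ->
  exists sigma : {rmorphism F -> F}, forall x, sigma x = x ^+ (p ^ m).
Proof.
move=> pF; elim: m => [|m [sigma sigmaE]]; first by exists idfun => x; rewrite expn0.
exists (pFrobenius_aut pF \o sigma) => x.
by rewrite /= sigmaE pFrobenius_autE -exprM expnSr.
Qed.

(** * Difference products under shifts, negation and field morphisms *)

Section DiffProd.

Variable F : finFieldType.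
Implicit Types (A D E : {set F}) (a : F).

Lemma diff_prod_reindex (g : F -> F) A a :
  injective g -> {in A, forall x, g x \in A} ->
  diff_prod A (g a) = \prod_(b in A | b != a) (g a - g b).
Proof.
move=> g_inj gA; have gAA : [set g x | x in A] = A.
  apply/eqP; rewrite eqEcard card_imset // leqnn andbT.
  by apply/subsetP => _ /imsetP[x xA ->]; apply: gA.
rewrite /diff_prod -{1}gAA big_imset_cond /=; last by move=> x y _ _ /g_inj.
by apply: eq_bigl => b; rewrite (inj_eq g_inj).
Qed.

Lemma diff_prod_shift A a h :
  {in A, forall x, x + h \in A} -> diff_prod A (a + h) = diff_prod A a.
Proof.
move=> hA; rewrite (@diff_prod_reindex (+%R^~ h)) //; last exact: addIr.
by apply: eq_bigr => b _; rewrite opprD addrACA subrr addr0.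
Qed.

Lemma diff_prod_rmorph (sigma : {rmorphism F -> F}) A a :
  {in A, forall x, sigma x \in A} ->
  diff_prod A (sigma a) = sigma (diff_prod A a).
Proof.
move=> sA; rewrite diff_prod_reindex //; last exact: fmorph_inj.
by rewrite rmorph_prod; apply: eq_bigr => b _; rewrite rmorphB.
Qed.

Lemma diff_prod_opp A a :
  {in A, forall x, - x \in A} ->
  diff_prod A (- a) = (-1) ^+ #|A :\ a| * diff_prod A a.
Proof.
move=> sA; rewrite (@diff_prod_reindex -%R) //; last exact: oppr_inj.
have AaE b : (b \in A) && (b != a) = (b \in A :\ a) by rewrite !inE andbC.
rewrite /diff_prod !(eq_bigl _ _ AaE) -prodrN; apply: eq_bigr => b _.
by rewrite opprB opprK addrC.
Qed.

(** The product has [#|A| - 1] factors, an odd number, and each changes sign. *)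
Lemma diff_prod_even_opp A a :
  {in A, forall x, - x \in A} -> ~~ odd #|A| -> a \in A ->
  diff_prod A (- a) = - diff_prod A a.
Proof.
move=> sA evA aA; rewrite diff_prod_opp // -signr_odd.
by move: evA; rewrite (cardsD1 a A) aA /= negbK => ->; rewrite expr1 mulN1r.
Qed.

Lemma diff_prodU D E a :
  [disjoint D & E] -> diff_prod (D :|: E) a = diff_prod D a * diff_prod E a.
Proof.
move=> dDE; rewrite /diff_prod !big_mkcondr /= -bigU //=.
by apply: eq_bigl => b; rewrite inE.
Qed.

(** Applying [sigma] to the product amounts to moving [a] to [sigma a]. On [E] this is negation,
    which flips the sign. For [a] in [D], [sigma a] agrees with [- a] up to a shift preserving [D],
    and with [a] up to a shift preserving [E], so only the factor from [D] changes sign. *)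
Lemma diff_prod_conj (sigma : {rmorphism F -> F}) D E :
  [disjoint D & E] -> ~~ odd #|D| -> ~~ odd #|E| ->
  {in D, forall x, - x \in D} -> {in E, forall x, - x \in E} ->
  {in D, forall x, sigma x \in D} -> {in E, forall x, sigma x = - x} ->
  {in D &, forall a x, x + (a + sigma a) \in D} ->
  {in D & E, forall a x, x + (a - sigma a) \in E} ->
  {in D :|: E, forall a,
    sigma (diff_prod (D :|: E) a) = - diff_prod (D :|: E) a}.
Proof.
move=> dDE evD evE oppD oppE sD sE shD shE a.
have sE' : {in E, forall x, sigma x \in E} by move=> x xE; rewrite sE ?oppE.
have sA : {in D :|: E, forall x, sigma x \in D :|: E}.
  by move=> x; rewrite !inE => /orP[/sD|/sE'] ->; rewrite ?orbT.
have diff_prod_sigma b : sigma (diff_prod (D :|: E) b) = diff_prod (D :|: E) (sigma b).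
  by rewrite diff_prod_rmorph.
rewrite diff_prod_sigma inE => /orP[aD|aE]; last first.
  rewrite sE // diff_prod_even_opp ?inE ?aE ?orbT //.
    by move=> x; rewrite !inE => /orP[/oppD|/oppE] ->; rewrite ?orbT.
  by rewrite cardsU (disjoint_setI0 dDE) cards0 subn0 oddD negb_add (negPf evD) (negPf evE).
rewrite !diff_prodU // -mulNr; congr (_ * _).
  rewrite -[sigma a]opprK diff_prod_even_opp // ?oppD ?sD //; congr (- _).
  rewrite -(@diff_prod_shift D _ (a + sigma a)) => [|x xD]; last exact: shD.
  by rewrite addrCA addNr addr0.
rewrite -(@diff_prod_shift E _ (a - sigma a)) => [|x xE]; last exact: shE.
by rewrite addrCA subrr addr0.
Qed.

End DiffProd.

(** * Sums of a set and an additive subgroup *)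

Section Sumset.

Variable F : finFieldType.
Implicit Types (S X : {set F}).

Definition sumset S X : {set F} := [set x.1 + x.2 | x in setX S X].

Lemma sumsetP S X a :
  reflect (exists y z, [/\ y \in S, z \in X & a = y + z]) (a \in sumset S X).
Proof.
apply: (iffP imsetP) => [[[y z]] | [y [z [yS zX ->]]]].
  by rewrite in_setX => /andP[yS zX] ->; exists y, z.
by exists (y, z); rewrite // in_setX yS.
Qed.

Lemma mem_sumset S X y z : y \in S -> z \in X -> y + z \in sumset S X.
Proof. by move=> yS zX; apply/sumsetP; exists y, z. Qed.

Lemma sumset_oppr S X :
  {in S, forall x, - x \in S} -> {in X, forall x, - x \in X} ->
  {in sumset S X, forall x, - x \in sumset S X}.
Proof.
move=> oS oX _ /sumsetP[y [z [yS zX ->]]].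
by rewrite opprD mem_sumset ?oS ?oX.
Qed.

Lemma sumset_shift S (X : {group F}) x h :
  x \in sumset S X -> h \in X -> x + h \in sumset S X.
Proof.
case/sumsetP=> y [z [yS zX ->]] hX.
by rewrite -addrA mem_sumset // -[_ + _]zmodMgE groupM.
Qed.

(** If y + z = y' + z', then y - y' = z' - z lies in both [U] and [X], hence is 0. *)
Lemma sumset_inj S (U X : {group F}) :
  S \subset U -> U :&: X = 1%g ->
  {in setX S X &, injective (fun x : F * F => x.1 + x.2)}.
Proof.
move=> sSU tiUX [y z] [y' z']; rewrite !in_setX /= => /andP[yS zX] /andP[yS' zX'] e.
have d : y - y' = z' - z by apply/eqP; rewrite subr_eq addrAC eq_sym subr_eq e addrC.
have : y - y' \in U :&: X.
  rewrite inE {2}d -[y - _]zmodMgE -[z' - _]zmodMgE -!zmodVgE.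
  by rewrite !groupM ?groupV ?(subsetP sSU).
rewrite tiUX inE => /eqP d0; congr (_, _); apply/eqP.
  by rewrite -subr_eq0 d0.
by rewrite eq_sym -subr_eq0 -d d0.
Qed.

Lemma card_sumset S (U X : {group F}) :
  S \subset U -> U :&: X = 1%g -> #|sumset S X| = (#|S| * #|X|)%N.
Proof.
by move=> sSU tiUX; rewrite card_in_imset ?cardsX //; apply: sumset_inj tiUX.
Qed.

Lemma sum_symmetric (X : {set F}) :
  2%:R != 0 :> F -> {in X, forall x, - x \in X} -> \sum_(x in X) x = 0.
Proof.
move=> F2 oX; apply/eqP; rewrite -[_ == 0]orFb -(negPf F2) -mulf_eq0 mulr_natl mulr2n.
rewrite {2}(reindex_inj (@oppr_inj F)) /= sumrN addr_eq0 opprK; apply/eqP.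
by apply: eq_bigl => x; apply/idP/idP => [/oX|/oX] //; rewrite opprK.
Qed.

(** Each coset y + X contributes [#|X|] times y plus the sum of [X], and both vanish. *)
Lemma sum_sumset S (U X : {group F}) :
  2%:R != 0 :> F -> S \subset U -> U :&: X = 1%g -> #|X|%:R = 0 :> F ->
  \sum_(x in sumset S X) x = 0.
Proof.
move=> F2 sSU tiUX X0; rewrite big_imset; last exact: sumset_inj tiUX.
rewrite (eq_bigl (fun x => (x.1 \in S) && (x.2 \in X))); last first.
  by case=> y z; rewrite in_setX.
rewrite -(pair_big (mem S) (mem X) +%R) /= big1 // => y yS.
rewrite big_split /= sumr_const -mulr_natr X0 mulr0 add0r sum_symmetric //.
by move=> x xX; rewrite -zmodVgE groupV.
Qed.

(** Greedy choice: a new element must avoid 0, [T] and the opposites of [T], at most 2j+1 elements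
    in all. The strict bound leaves room for 0, which is its own opposite. *)
Lemma half_set (X : {set F}) j :
  2%:R != 0 :> F -> {in X, forall x, - x \in X} -> (j.*2 < #|X|)%N ->
  exists T : {set F}, [/\ T \subset X, #|T| = j
    & [disjoint T & [set - x | x in T]]].
Proof.
move=> F2 oX; elim: j => [|j IHj] jX.
  by exists set0; rewrite sub0set cards0 disjoints_subset sub0set.
have [|T [sTX cT dT]] := IHj; first by lia.
pose N : {set F} := [set - x | x in T].
have cN : #|N| = j by rewrite card_imset ?cT //; apply: oppr_inj.
have /subsetPn[x xX] : ~~ (X \subset 0 |: (T :|: N)).
  apply: contraTN jX => /subset_leq_card; rewrite -leqNgt => le1.
  apply: leq_trans le1 _; apply: leq_trans (leq_card_setU _ _) _.
  by have [le2 _] := leq_card_setU T N; move: le2; rewrite cards1 cT cN; lia.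
rewrite !inE !negb_or => /and3P[x0 xT xN].
have NxT : - x \notin T.
  by apply: contraNN xN => h; apply/imsetP; exists (- x); rewrite ?opprK.
exists (x |: T); split; first by rewrite subUset sub1set xX.
  by rewrite cardsU1 xT cT.
apply/pred0Pn => -[y] /=; rewrite !inE => /andP[yT /imsetP[z]].
rewrite !inE => zT yz; move: yT zT; rewrite {}yz.
case/orP => [/eqP zx|zT'] /orP[/eqP zx'|zT].
- move: zx x0; rewrite zx' => /eqP; rewrite eq_sym -addr_eq0 -mulr2n -mulr_natl.
  by rewrite mulf_eq0 (negPf F2) /= => ->.
- by move: NxT; rewrite -zx opprK zT.
- by move: NxT; rewrite -zx' zT'.
by move/pred0Pn: dT; apply; exists (- z); rewrite /= zT' imset_f.
Qed.

End Sumset.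

(** * Additive subgroups and a supply of squares *)

(** Each eigenspace consists of roots of some X^r - cX, so has at most r elements; the two together
    span a field of r^2 elements, which forces equality. *)
Lemma sign_eigengroups (F : finFieldType) (r : nat) (sigma : {rmorphism F -> F}) :
  (1 < r)%N -> #|F| = (r ^ 2)%N -> 2%:R != 0 :> F ->
  (forall x, sigma x = x ^+ r) ->
  exists K M : {group F}, [/\ #|K| = r, #|M| = r,
    forall x, (x \in K) = (sigma x == x) & forall x, (x \in M) = (sigma x == - x)].
Proof.
move=> r1 cF F2 sE.
have gK : group_set [set x | sigma x == x].
  apply/group_setP; split=> [|x y]; rewrite !inE ?rmorph0 // => /eqP ex /eqP ey.
  by rewrite rmorphD ex ey.
have gM : group_set [set x | sigma x == - x].
  apply/group_setP; split=> [|x y]; rewrite !inE ?rmorph0 ?oppr0 // => /eqP ex /eqP ey.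
  by rewrite rmorphD ex ey opprD.
pose K := Group gK; pose M := Group gM.
have bound (c : F) : (#|[set x : F | sigma x == (c * x)%R]| <= r)%N.
  have sc : (size (- (c *: 'X : {poly F})) < size ('X^r : {poly F}))%N.
    rewrite size_polyN size_polyXn; apply: leq_ltn_trans (size_scale_leq _ _) _.
    by rewrite size_polyX.
  have := @card_roots_set F ('X^r - c *: 'X) setT.
  rewrite -size_poly_eq0 size_polyDl // size_polyXn ltnS => /(_ isT); apply: leq_trans.
  apply/subset_leq_card/subsetP => x; rewrite !inE rootE !hornerE sE => /eqP->.
  by rewrite subrr.
have K_le : (#|K| <= r)%N.
  apply: leq_trans (bound 1); apply: subset_leq_card; apply/subsetP => x.
  by rewrite !inE mul1r.
have M_le : (#|M| <= r)%N.
  apply: leq_trans (bound (-1)); apply: subset_leq_card; apply/subsetP => x.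
  by rewrite !inE mulN1r.
have KM_ge : (r ^ 2 <= #|K| * #|M|)%N.
  rewrite -cF -cardsT -cardsX.
  apply: leq_trans (leq_imset_card (fun x : F * F => x.1 + x.2) _).
  apply/subset_leq_card/subsetP => x _.
  have ssx : sigma (sigma x) = x by rewrite !sE -exprM mulnn -cF expf_card.
  (* The symmetric and antisymmetric parts of x under the involution [sigma]. *)
  apply/imsetP; exists (2%:R^-1 * (x + sigma x), 2%:R^-1 * (x - sigma x)).
    rewrite in_setX !inE !rmorphM !fmorphV !rmorph_nat rmorphD rmorphB ssx.
    by rewrite addrC eqxx -mulrN opprB eqxx.
  by rewrite /= -mulrDr addrACA subrr addr0 -mulr2n -[x *+ 2]mulr_natl mulKf.
have r0 := ltnW r1; rewrite -mulnn in KM_ge.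
exists K, M; split=> [|| x | x]; rewrite ?inE //; apply/eqP.
  rewrite eqn_leq K_le -(leq_pmul2r r0).
  by apply: leq_trans KM_ge _; rewrite leq_mul2l M_le orbT.
rewrite eqn_leq M_le -(leq_pmul2l r0).
by apply: leq_trans KM_ge _; rewrite leq_mul2r K_le orbT.
Qed.

(** In characteristic p the additive group [M] is elementary abelian, so it has a subgroup of each
    order p^e with e <= m, and every subgroup has a complement. *)
Lemma abelem_TI_subgroups (F : finFieldType) (p m e : nat) (M : {group F}) :
  p \in [pchar F] -> #|M| = (p ^ m)%N -> (e <= m)%N ->
  exists H L : {group F}, [/\ H \subset M, L \subset M, #|H| = (p ^ e)%N,
    #|L| = (p ^ (m - e))%N & L :&: H = 1%g].
Proof.
move=> pF cM em; have p_pr := pcharf_prime pF.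
have abM : (p.-abelem M)%g.
  apply/abelemP => //; split; first exact: zmod_abelian.
  by move=> x _; rewrite zmodXgE mulrn_pchar.
have [|H [sHM _ cH]] := normal_pgroup (r := e) (abelem_pgroup abM) (normal_refl M).
  by rewrite cM pfactorK.
have [L defM] := abelem_split_dprod abM sHM.
have [_ HL _ tiHL] := dprodP defM; exists H, L; split=> //.
- by rewrite -HL mulG_subr.
- apply/eqP; rewrite -(eqn_pmul2l (cardG_gt0 H)) (dprod_card defM) cM cH.
  by rewrite -expnD subnKC.
- by rewrite setIC.
Qed.

(** The signs cancel in w / d, so it is fixed by the r-th power and its (r-1)-th power is 1. As r -
    1 divides (r^2 - 1)/2, Euler's criterion applies. *)
Lemma ratio_is_square (F : finFieldType) (r : nat) (w d : F) :
  odd r -> #|F| = (r ^ 2)%N -> w ^+ r = - w -> d ^+ r = - d -> w != 0 -> d != 0 ->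
  exists y, y ^+ 2 = w / d.
Proof.
move=> oddr cF wr dr w0 d0; apply: euler_criterion; rewrite cF ?oddX //.
have [j rE] : exists j, r = j.*2.+1 by exists r./2; rewrite -[LHS]odd_double_half oddr.
(* With r = 2j+1, the cofactor [j.+1] is (r+1)/2. *)
have -> : ((r ^ 2).-1./2 = r.-1 * j.+1)%N.
  by rewrite rE -mulnn /= -muln2; lia.
suff -> : (w / d) ^+ (r.-1 * j.+1) = ((w / d) ^+ r.-1) ^+ j.+1.
  suff -> : (w / d) ^+ r.-1 = 1 by rewrite expr1n.
  have x0 : w / d != 0 by rewrite mulf_neq0 ?invr_eq0.
  apply: (mulfI x0); rewrite mulr1 -exprS prednK ?rE // -rE.
  by rewrite expr_div_n wr dr invrN mulrNN.
by rewrite exprM.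
Qed.

(** * The choice of the evaluation points *)

Theorem theorem3p7 (p m r q t s t' n : nat) (F : finFieldType)
    (p_prime : prime p) (p_odd : odd p) (m_gt0 : (0 < m)%N)
    (def_r : r = (p ^ m)%N) (def_q : q = (r ^ 2)%N) (cardF : #|F| = q)
    (t_even : ~~ odd t) (s_even : ~~ odd s)
    (t_ge1 : (1 <= t)%N) (t_le_r : (t <= r)%N)
    (def_t' : t' = up_log p t)
    (s_ge0 : (0 <= s)%N) (s_le : (s <= p ^ (m - t') - 1)%N)
    (def_n : n = (t * r + s * p ^ t')%N) :
  exists C : {vspace 'rV[F]_n}, NMDS C /\ self_dual C.
Proof.
have p1 := prime_gt1 p_prime.
(* Being even, t is at least 2; this later makes t' positive, so that p divides |H|, and makes [I]
   nonempty. *)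
have t1 : (1 < t)%N by case: (t) t_even t_ge1 => [|[]].
have cF : #|F| = (r ^ 2)%N by rewrite cardF.
have pF : p \in [pchar F].
  by apply: (@card_finPcharP F p (m * 2)) => //; rewrite cF def_r expnM.
have F2 : 2%:R != 0 :> F.
  by rewrite -(dvdn_pcharf pF) dvdn_prime2 //; apply: contraL p_odd => /eqP->.
have r_odd : odd r by rewrite def_r oddX p_odd orbT.
have r1 : (1 < r)%N by rewrite def_r -(expn0 p) ltn_exp2l.
have [sigma sE'] := frobenius_rmorphism m pF.
have sE x : sigma x = x ^+ r by rewrite def_r.
have [K [M [cK cM inK inM]]] := sign_eigengroups r1 cF F2 sE.
have t'm : (t' <= m)%N by rewrite def_t' up_log_min // -def_r.
have [H [L [sHM sLM cH cL tiLH]]] := abelem_TI_subgroups pF (etrans cM def_r) t'm.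
have tiMK : M :&: K = 1%g.
  apply/setP => x; rewrite !inE inM inK; apply/andP/eqP => [[/eqP-> ]|->].
    rewrite eq_sym -addr_eq0 -mulr2n -mulr_natl mulf_eq0 (negPf F2) => /eqP //.
  by rewrite rmorph0 oppr0.
have oppG (X : {group F}) x : x \in X -> - x \in X by rewrite -zmodVgE groupV.
have tE : t = t./2.*2 by rewrite even_halfK.
have sE2 : s = s./2.*2 by rewrite even_halfK.
(* Equality is excluded by parity; [half_set] needs the strict bound. *)
have t_lt : (t < p ^ t')%N.
  rewrite ltn_neqAle def_t' up_logP // andbT.
  by apply: contraNneq t_even => ->; rewrite oddX p_odd orbT.
have s_lt : (s < p ^ (m - t'))%N.
  by have := expn_gt0 p (m - t'); rewrite (ltnW p1) /=; lia.
have [|T [sTH cT dT]] := @half_set _ H t./2 F2 (oppG H); first by rewrite -tE cH.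
have [|R [sRL cR dR]] := @half_set _ L s./2 F2 (oppG L); first by rewrite -sE2 cL.
pose B := T :|: [set - x | x in T]; pose S := R :|: [set - x | x in R].
have cB : #|B| = t.
  rewrite cardsU (disjoint_setI0 dT) cards0 subn0 card_imset ?cT ?addnn -?tE //.
  exact: oppr_inj.
have cS : #|S| = s.
  rewrite cardsU (disjoint_setI0 dR) cards0 subn0 card_imset ?cR ?addnn -?sE2 //.
  exact: oppr_inj.
have sBH : B \subset H.
  rewrite subUset sTH; apply/subsetP => _ /imsetP[x xT ->].
  exact/oppG/(subsetP sTH).
have sSL : S \subset L.
  rewrite subUset sRL; apply/subsetP => _ /imsetP[x xR ->].
  exact/oppG/(subsetP sRL).
(* An element 0 of [R] would be its own opposite. This keeps the cosets forming [E] away from [H]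
   itself. *)
have S0 : 0 \notin S.
  rewrite -[0]oppr0 inE (mem_imset _ _ (@oppr_inj F)) oppr0 orbb.
  apply/negP => R0; case/pred0Pn: dR; exists 0; rewrite /= R0 -[0]oppr0.
  by rewrite (mem_imset _ _ (@oppr_inj F)).
have oppU (X : {set F}) :
    {in X :|: [set - x | x in X], forall x, - x \in X :|: [set - x | x in X]}.
  move=> x; rewrite !inE => /orP[xX|/imsetP[y yX ->]]; last by rewrite opprK yX.
  by rewrite imset_f ?orbT.
have inB x : x \in B -> x \in M by move/(subsetP sBH)/(subsetP sHM).
pose D := sumset B K; pose E := sumset S H; pose A := D :|: E.
have sBM : B \subset M := subset_trans sBH sHM.
have sE_M x : x \in E -> x \in M.
  case/sumsetP=> y [z [/(subsetP sSL)/(subsetP sLM) yM /(subsetP sHM) zM ->]].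
  exact: groupM.
have cD : #|D| = (t * r)%N by rewrite (card_sumset sBM tiMK) cB cK.
have cE : #|E| = (s * p ^ t')%N by rewrite (card_sumset sSL tiLH) cS cH.
(* A common point b + z = l + h has z in both [M] and [K], so z = 0; then l = b - h lies in both [L]
   and [H], so l = 0, contradicting [S0]. *)
have dDE : [disjoint D & E].
  apply/pred0P => x /=; apply/andP => -[/sumsetP[b [z [bB zK xE]]]].
  case/sumsetP=> l [h [lS hH]]; rewrite xE => e.
  have zE : z = l + h - b by rewrite -e addrC addKr.
  have : z \in M :&: K.
    rewrite inE zK andbT zE; apply: groupM; last by rewrite groupV inB.
    by apply: groupM; [apply/(subsetP sLM)/(subsetP sSL) | apply: (subsetP sHM)].
  rewrite tiMK inE => /eqP z0; have : l \in L :&: H.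
    rewrite inE (subsetP sSL) //= (_ : l = b - h).
      by rewrite -zmodMgE -zmodVgE groupM ?groupV // (subsetP sBH).
    by rewrite -[LHS](addrK h) -e z0 addr0.
  by rewrite tiLH inE => /eqP l0; move: S0; rewrite -[0]l0 lS.
have cA : #|A| = n by rewrite cardsU (disjoint_setI0 dDE) cards0 subn0 cD cE.
have oD : {in D, forall x, - x \in D} by apply: sumset_oppr (oppU T) (oppG K).
have oE : {in E, forall x, - x \in E} by apply: sumset_oppr (oppU R) (oppG H).
have sigmaM x : x \in M -> sigma x = - x by rewrite inM => /eqP.
have sigmaK x : x \in K -> sigma x = x by rewrite inK => /eqP.
have delta_conj : {in A, forall a, sigma (diff_prod A a) = - diff_prod A a}.
  apply: diff_prod_conj => //.
  - by rewrite cD oddM negb_and t_even.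
  - by rewrite cE oddM negb_and s_even.
  - move=> _ /sumsetP[b [z [bB zK ->]]]; rewrite rmorphD (sigmaK _ zK) sigmaM ?inB //.
    by rewrite mem_sumset // oppU.
  - by move=> x /sE_M/sigmaM.
  (* For a = b + z, a + sigma a is 2z, in [K]; in the next case a - sigma a is 2b, in [H]. *)
  - move=> _ x /sumsetP[b [z [bB zK ->]]] xD; apply: sumset_shift => //.
    rewrite rmorphD (sigmaK _ zK) sigmaM ?inB // addrACA subrr add0r.
    exact: groupM.
  move=> _ x /sumsetP[b [z [bB zK ->]]] xE; apply: sumset_shift => //.
  rewrite rmorphD (sigmaK _ zK) sigmaM ?inB // opprD opprK addrACA subrr addr0.
  by apply: groupM; apply: (subsetP sBH).
have [w wM w0] : exists2 w, w \in M & w != 0.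
  have : ~~ (M \subset [set 0]).
    by apply: contraL r1 => /subset_leq_card; rewrite cards1 cM -leqNgt.
  by case/subsetPn => w wM; rewrite inE => w0; exists w.
(* The default 0 is never taken on [A], where [ratio_is_square] supplies a square root. *)
pose v a : F := odflt 0 [pick y | y ^+ 2 == w / diff_prod A a].
have vE : {in A, forall a, v a ^+ 2 = w / diff_prod A a}.
  move=> a aA; rewrite /v; case: pickP => [y /eqP //|noy].
  have [||y yE] := ratio_is_square r_odd cF _ _ w0 (diff_prod_neq0 A a).
  - by rewrite -sE sigmaM.
  - by rewrite -sE delta_conj.
  by have := noy y; rewrite yE eqxx.
pose I := sumset T K :|: sumset R H.
have sTM : T \subset M := subset_trans sTH sHM.
have sTK : sumset T K \subset D by apply/imsetS/setXS; rewrite ?subsetUl.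
have sRH : sumset R H \subset E by apply/imsetS/setXS; rewrite ?subsetUl.
have dTR : [disjoint sumset T K & sumset R H].
  by apply: disjointWl sTK _; apply: disjointWr sRH _.
have cI : #|I| = (t./2 * r + s./2 * p ^ t')%N.
  rewrite cardsU (disjoint_setI0 dTR) cards0 subn0.
  by rewrite (card_sumset sTM tiMK) (card_sumset sRL tiLH) cT cR cK cH.
have cAI : #|A| = #|I|.*2 by rewrite cA cI def_n {1}tE {1}sE2 doubleD !doubleMl.
have dvd0 j : (0 < j)%N -> (p ^ j)%:R = 0 :> F.
  by move=> j0; rewrite natrX (pcharf0 pF) expr0n eqn0Ngt j0.
have t'0 : (0 < t')%N by rewrite def_t' up_log_gt0 p1.
(* The cosets of [K] and of [H] each have sum 0, since |K| and |H| are positive powers of p and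
   vanish in [F]. *)
have sumI : \sum_(x in I) x = 0.
  rewrite (eq_bigl [in [predU sumset T K & sumset R H]]) => [|x]; last by rewrite !inE.
  rewrite bigU //=.
  rewrite (sum_sumset F2 sTM tiMK) ?cK ?def_r ?dvd0 //.
  by rewrite (sum_sumset F2 sRL tiLH) ?cH ?dvd0 ?addr0.
have sumA : \sum_(x in A) x = 0.
  by apply: sum_symmetric => // x; rewrite !inE => /orP[/oD|/oE] ->; rewrite ?orbT.
rewrite -cA; apply: (@twisted_code_NMDS F A I #|I| w v) => //; last exact: setUSS.
by rewrite cI addn_gt0 muln_gt0 half_gt0 t1 ltnW.
Qed.
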